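(* Let $v$ be a leaf of the path $P_n$, and let $c_\lambda$ be the coefficient of $e_\lambda z^{|\lambda|}$ in $\mathcal{X}_{P_v}(z)=\sum_{n\ge 1}X_{P_{n,v}}z^{n+1}$, i.e. $\mathcal{X}_{P_v}(z)=\sum_\lambda c_\lambda e_\lambda z^{|\lambda|}$. Then: (a) $c_{(k)}=2k$ for $k\ge 3$, and $c_{(2)}=2$; (b) $c_{(k-1,1)}=2(k-2)$ for $k\ge 4$; (c) $c_{(k-2,2)}=4(k-3)$ for $k\ge 5$; (d) $c_{(i,j)}=2i(j-1)+2j(i-1)=2(2ij-i-j)$ for $i>j\ge 3$; (e) $c_{(i,i)}=2i(i-1)$ for $i\ge 3$; (f) $c_{(3,2^k)}=8$ and $c_{(3,2^k,1)}=4$ for $k\ge 2$; (g) if $\ell(\mu)\ge 2$ and $c_{1\cup\mu}\ne 0$, then $1\notin\mathrm{supp}(\mu)$ and there exists $a\ge 3$ with $a\in\mathrm{supp}(\mu)$; in particular $c_{(2^k,1)}=0$. For $\ell(\mu)\ge 2$, $c_{1\cup\mu}$ equals twice the coefficient of $e_\mu z^{|\mu|}$ in $G(z)\,G_{\ge 3}(z)\,G(z)^{\ell(\mu)-2}$, and it equals $$2\sum_{\substack{(a,b):\ a,b\in\mathrm{supp}(\mu)\\ a\ge 2,\ b\ge 3}}(a-1)(b-1)\,\varepsilon((\mu-a)-b);$$ (h) assume $1\notin\mathrm{supp}(\lambda)$ and $\ell(\lambda)\ge 2$. If $c_\lambda\ne 0$, then $\lambda$ contains at least one part of size at least $3$;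 in particular $c_{(2^k)}=0$ (for $k\ge 2$). The coefficient $c_\lambda$ equals twice the coefficient of $e_\lambda z^{|\lambda|}$ in $K(z)\,G_{\ge 3}(z)\,G(z)^{\ell(\lambda)-2}$, and it equals $$2\sum_{\substack{(a,b):\ a,b\in\mathrm{supp}(\lambda)\\ a\ge 2,\ b\ge 3}}a(b-1)\,\varepsilon((\lambda-a)-b).$$
   Context: The chromatic symmetric function of a finite simple graph $H=(V,E)$ is $X_H=\sum_\kappa\prod_{u\in V}x_{\kappa(u)}$, the sum over all proper colorings $\kappa:V\to\mathbb{Z}_{>0}$. $P_n$ is the path on $n$ vertices. The twin of a graph at a vertex $v$ is obtained by adding a new vertex $v'$ joined to $v$ and to all neighbors of $v$; $P_{n,v}$ is $P_n$ twinned at an end vertex $v$ (for $n=1$, the only vertex). $e_\lambda$ are the elementary symmetric functions. For a partition $\lambda$: $\ell(\lambda)$ is its number of parts, $m_j(\lambda)$ the multiplicity of $j$, $\mathrm{supp}(\lambda)=\{j: m_j(\lambda)\ge 1\}$, $\lambda\cup\mu$ the partition whose multiset of parts is the union of those of $\lambda$ and $\mu$ (so $1\cup\mu$ adds a part $1$), and $2^k$ denotes $k$ parts equal to $2$. Define $$\varepsilon(\lambda)=\ell(\lambda)!\prod_{j\in\mathrm{supp}(\lambda)}\frac{(j-1)^{m_j(\lambda)}}{m_j(\lambda)!},\qquad \varepsilon(\emptyset)=1.$$ If $a$ is a part of $\lambda$, $\lambda-a$ is $\lambda$ with one part equal to $a$ removed; if $a$ is not a part of $\lambda$, $\varepsilon(\lambda-a)=0$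 by convention (so $\varepsilon((\lambda-a)-b)=0$ if $b$ is not a part of $\lambda-a$). The sums are over ordered pairs $(a,b)$. Notation: $K(z)=\sum_{i\ge 2}ie_iz^i$, $G(z)=\sum_{i\ge 2}(i-1)e_iz^i$, $G_{\ge 3}(z)=\sum_{i\ge 3}(i-1)e_iz^i$. *)

(* Defs.v *)
From HB Require Import structures.
From mathcomp Require Import all_boot all_order all_algebra.
From mathcomp Require Import mpoly.

Set Implicit Arguments.
Unset Strict Implicit.
Unset Printing Implicit Defensive.

Import GRing.Theory.
Local Open Scope ring_scope.

Record sgraph := SGraph {
  vertex :> finType;
  adj : rel vertex;
  adj_sym : ssrbool.symmetric adj;
  adj_irr : irreflexive adj }.

Section PathGraph.
Variable n : nat.

Definition path_adj (i j : 'I_n) : bool := (i.+1 == j)%N || (j.+1 == i)%N.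

Lemma path_adj_sym : ssrbool.symmetric path_adj.
Proof. by move=> i j; rewrite /path_adj orbC. Qed.

Lemma path_adj_irr : irreflexive path_adj.
Proof. by move=> i; rewrite /path_adj orbb gtn_eqF. Qed.

Definition path_graph : sgraph := SGraph path_adj_sym path_adj_irr.
End PathGraph.

Definition path_end n (v : path_graph n.+1) : bool :=
  (v == ord0) || (v == ord_max).

(* The added vertex v' is None. *)
Section Twin.
Variables (H : sgraph) (v : H).

Definition twin_adj (x y : option H) : bool :=
  match x, y with
  | Some a, Some b => adj a b
  | Some a, None | None, Some a => (a == v) || adj v a
  | None, None => false
  end.

Lemma twin_adj_sym : ssrbool.symmetric twin_adj.
Proof. by case=> [a|] [b|] //=; rewrite adj_sym. Qed.

Lemma twin_adj_irr : irreflexive twin_adj.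
Proof. by case=> [a|] //=; rewrite adj_irr. Qed.

Definition twin : sgraph := SGraph twin_adj_sym twin_adj_irr.
End Twin.

(* A symmetric function, as an element of the inverse limit of the rings of   *)
(* symmetric polynomials: the component at N is f(x_1, ..., x_N, 0, 0, ...),  *)
(* with x_1, ..., x_N written 'X_0, ..., 'X_(N-1). Ring operations are        *)
(* componentwise, and two symmetric functions are equal iff all of their      *)
(* components are.                                                            *)
Definition symfun := forall N : nat, {mpoly rat[N]}.

Definition proper_coloring (H : sgraph) N (kappa : {ffun H -> 'I_N}) : bool :=
  [forall x, forall y, adj x y ==> (kappa x != kappa y)].

Definition chromsym (H : sgraph) : symfun := fun N =>
  \sum_(kappa : {ffun H -> 'I_N} | proper_coloring kappa)
    \prod_(u : H) 'X_(kappa u).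

Definition elem (k : nat) : symfun := fun N => @mesym N rat k.

Definition elem_part (lam : seq nat) : symfun := fun N =>
  \prod_(i <- lam) elem i N.

Definition is_part (lam : seq nat) : bool := sorted geq lam && (0%N \notin lam).

Definition part_union (lam mu : seq nat) : seq nat := sort geq (lam ++ mu).

Fixpoint parts_upto (m n : nat) : seq (seq nat) :=
  if m is m'.+1 then
    [seq nseq k m ++ s | k <- iota 0 (n %/ m).+1, s <- parts_upto m' (n - k * m)]
  else if n is 0%N then [:: [::]] else [::].

Definition partitions (n : nat) : seq (seq nat) := parts_upto n n.

(* Formal power series in z over symmetric functions: F n is the coefficient  *)
(* of z^n.                                                                    *)
Definition symseries := nat -> symfun.

Definition ser_one : symseries := fun n N => (n == 0%N)%:R.

Definition ser_mul (F G : symseries) : symseries := fun n N =>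
  \sum_(i < n.+1) F i N * G (n - i)%N N.

Definition ser_exp (F : symseries) (k : nat) : symseries :=
  iter k (ser_mul F) ser_one.

Definition serK : symseries := fun i N =>
  if (2 <= i)%N then i%:R *: elem i N else 0.

Definition serG : symseries := fun i N =>
  if (2 <= i)%N then (i%:R - 1) *: elem i N else 0.

Definition serG3 : symseries := fun i N =>
  if (3 <= i)%N then (i%:R - 1) *: elem i N else 0.

(* v n is the chosen vertex of the path on n + 1 vertices. *)
Definition serXPv (v : forall n, path_graph n.+1) : symseries := fun m =>
  match m with
  | n.+2 => chromsym (twin (v n))
  | _ => fun N => 0
  end.

(* F = \sum_lam c lam * e_lam * z^|lam|; the values of c outside partitions   *)
(* are irrelevant.                                                            *)
Definition e_expansion (F : symseries) (c : seq nat -> rat) : Prop :=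
  forall n N, F n N = \sum_(lam <- partitions n) c lam *: elem_part lam N.

(* The coefficient of e_lam * z^|lam| in F is x. *)
Definition e_coef_is (F : symseries) (lam : seq nat) (x : rat) : Prop :=
  (exists c, e_expansion F c) /\ (forall c, e_expansion F c -> c lam = x).

Definition epsilon (lam : seq nat) : rat :=
  (size lam)`!%:R *
  \prod_(j <- undup lam)
    ((j%:R - 1) ^+ count_mem j lam / (count_mem j lam)`!%:R).

Definition epsilon_sub2 (lam : seq nat) (a b : nat) : rat :=
  if (a \in lam) && (b \in rem a lam) then epsilon (rem b (rem a lam)) else 0.

Lemma mem_parts_upto m n s :
  (s \in parts_upto m n) = [&& is_part s, all (leq^~ m) s & sumn s == n].
Proof.
elim: m n s => [|m IH] n s.
  case: s => [|x s]; first by case: n.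
  have -> : [&& is_part (x :: s), all (leq^~ 0%N) (x :: s)
               & sumn (x :: s) == n] = false.
    by apply/negP => /and3P[/andP[_ s0] /=]; case: x s0 => // s0.
  by case: n.
apply/allpairsPdep/idP => [[k [t []]]|].
  rewrite mem_iota add0n ltnS leq_divRL // => /= kn.
  rewrite IH => /and3P[/andP[st t0] tm /eqP sumt] ->; apply/and3P; split.
  - apply/andP; split; last by rewrite mem_cat negb_or t0 mem_nseq andbF.
    elim: {kn sumt} k => [|k IHk] //=; case: k IHk => [|k] /= IHk; last first.
      by rewrite /geq /= leqnn.
    by case: t st tm {t0 IHk} => //= x t ->; rewrite /geq /= => /andP[/leqW->].
  - rewrite all_cat all_nseq leqnn orbT /=.
    by apply: sub_all tm => x /leqW.
  - by rewrite sumn_cat sumn_nseq sumt mulnC subnKC.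
move=> /and3P[/andP[ss s0] sm /eqP sums].
have [k [t [Es tm]]] : exists k t, s = nseq k m.+1 ++ t /\ all (leq^~ m) t.
  elim: s ss sm {s0 sums} => [|x s IHs] /=; first by exists 0%N, [::].
  move=> px /andP[]; rewrite leq_eqVlt => /orP[/eqP ex|xm] sm.
    have [k [t [-> tm]]] := IHs (path_sorted px) sm.
    by exists k.+1, t; rewrite ex.
  exists 0%N, (x :: s); split=> //=; rewrite -ltnS xm /=.
  have tr : transitive geq by move=> a b c ba ac; apply: leq_trans ac ba.
  have := order_path_min tr px; apply: sub_all => y yx.
  exact: leq_trans yx _.
have kn : (k * m.+1 <= n)%N by rewrite -sums Es sumn_cat sumn_nseq mulnC leq_addr.
exists k, t; split=> //; first by rewrite mem_iota add0n ltnS leq_divRL.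
rewrite IH tm andTb; apply/andP; split; last first.
  by rewrite -sums Es sumn_cat sumn_nseq mulnC addKn.
move: ss s0; rewrite /is_part Es mem_cat negb_or => ss /andP[_ ->].
by rewrite andbT; apply: (subseq_sorted _ (suffix_subseq _ _) ss) => a b c ba ac;
   apply: leq_trans ac ba.
Qed.

Lemma mem_partitions n s :
  (s \in partitions n) = is_part s && (sumn s == n).
Proof.
rewrite mem_parts_upto; case: eqP => [<-|]; rewrite ?andbF // !andbT.
suff -> : all (leq^~ (sumn s)) s by rewrite andbT.
elim: s => //= x s IH; rewrite leq_addr /=.
by apply: sub_all IH => y ys; apply: leq_trans ys (leq_addl _ _).
Qed.

Lemma uniq_partitions n : uniq (partitions n).
Proof.
rewrite /partitions; move: {1}n => m; elim: m n => [|m IH] n; first by case: n.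
have Hm j t i : t \in parts_upto m i -> count_mem m.+1 (nseq j m.+1 ++ t) = j.
  rewrite mem_parts_upto => /and3P[_ tm _].
  rewrite count_cat count_nseq /= eqxx mul1n.
  rewrite (eq_in_count (a2 := pred0)) ?count_pred0 ?addn0 // => x xt /=.
  by apply/eqP => xm; have := allP tm x xt; rewrite xm ltnn.
apply: allpairs_uniq_dep => [|k _|]; [exact: iota_uniq | exact: IH |].
move=> _ _ /allpairsPdep[k [s [_ hs ->]]] /allpairsPdep[l [t [_ ht ->]]] /= E.
have kl : k = l by rewrite -(Hm k s _ hs) E (Hm l t _ ht).
by move: E; rewrite kl => /eqP; rewrite eqseq_cat // eqxx /= => /eqP ->.
Qed.

(* Main.v *)
Require Import Defs.
From HB Require Import structures.
From mathcomp Require Import all_boot all_order all_algebra.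
From mathcomp Require Import mpoly ring zify.

Set Implicit Arguments.
Unset Strict Implicit.
Unset Printing Implicit Defensive.

Import GRing.Theory.
Local Open Scope ring_scope.

(* Let P(z) be the series of the paths (with X_{P_0} = 1) and E(z) that of    *)
(* the e_i. Counting words without equal adjacent letters by their first      *)
(* letter gives P = E + G P, that is P = E / (1 - G). Triple deletion in the  *)
(* triangle of the twinned path gives                                         *)
(*   X_{P_{n,v}} = 2 X_{P_{n+1}} - X_{P_2} X_{P_{n-1}},                       *)
(* so the series of the twinned paths is 2 (E_{>=2} + G_{>=3} P). Here        *)
(* 1 / (1 - G) has e-coefficients epsilon, and multiplying a series with      *)
(* coefficients c by \sum_i h_i e_i z^i produces the coefficients             *)
(* \sum_{a in supp(lam)} h_a c_{lam - a}. The coefficients are unique because *)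
(* the e_i are algebraically independent.                                     *)

(** * Expansions in elementary symmetric functions *)

(** Everything is read off coefficientwise from 2 (E_{>=2} + G_{>=3} P). A single part k >= 3
    receives 1 from E_{>=2} and k - 1 from G_{>=3}, hence c = 2k. With at least two parts only the
    second term matters, and ([twin_coefE]) c_lam is twice the sum of (b-1) a epsilon(lam - b - a)
    over b >= 3 in lam and a in lam - b. The factor G_{>=3} forces a part of size at least 3. If 1
    is not a part, the weight a is that of K, which is (h). A part 1 makes epsilon vanish and cannot
    be chosen as b, so in the union of 1 and mu it has to be the removed a; what is left is twice
    the sum of (b-1) epsilon(mu - b) ([twin_coef_cons1]), and unfolding epsilon once more by
    [epsilon_rec] produces the factor G of (g).

    The identity rests on [smirnov_words] (P = E + G P) and [chromsym_twin] (triple deletion).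
    [e_expansion_lin_mul] and [epsilon_rec] turn it into coefficients in [e_expansion_path] and
    [e_expansion_twin]; [e_coef_triple] matches the double sums with the triple products, and
    [e_expansion_uniq] makes these values the only possible ones. *)

Lemma geq_trans : transitive geq.
Proof. by move=> a b c ba ac; apply: leq_trans ac ba. Qed.

Lemma is_part_eq (lam mu : seq nat) :
  is_part lam -> is_part mu -> perm_eq lam mu -> lam = mu.
Proof.
move=> /andP[sl _] /andP[sm _]; apply: (sorted_eq geq_trans) => //.
by move=> a b /andP[ab ba]; apply/eqP; rewrite eqn_leq; apply/andP.
Qed.

Lemma is_part_rem a lam : is_part lam -> is_part (rem a lam).
Proof.
move=> /andP[sl l0]; apply/andP; split.
  exact: (subseq_sorted geq_trans (rem_subseq a lam)).
by apply: contra l0 => /mem_rem.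
Qed.

Lemma is_part_union lam mu :
  0%N \notin lam -> 0%N \notin mu -> is_part (part_union lam mu).
Proof.
move=> l0 m0; apply/andP; split; first by apply: sort_sorted => a b; lia.
by rewrite mem_sort mem_cat negb_or l0.
Qed.

Lemma sumn_rem a lam : a \in lam -> sumn lam = (a + sumn (rem a lam))%N.
Proof. by move=> /perm_to_rem/perm_sumn. Qed.

Lemma elem_part_perm lam mu N : perm_eq lam mu -> elem_part lam N = elem_part mu N.
Proof. by move=> p; apply: perm_big. Qed.

Lemma elem_part_rem a lam N :
  a \in lam -> elem_part lam N = elem a N * elem_part (rem a lam) N.
Proof. by move=> /perm_to_rem/elem_part_perm->; rewrite /elem_part big_cons. Qed.

(** * Algebraic independence of the elementary symmetric polynomials *)

Section Uniqueness.
Variable n : nat.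

Definition part_mnm (lam : seq nat) : 'X_{1..n} :=
  [multinom count_mem i.+1 lam | i < n].

Lemma elem_part_comp (lam : seq nat) :
  all (fun i => 0 < i <= n)%N lam ->
  elem_part lam n = 'X_[part_mnm lam] \mPo [tuple mesym n rat i.+1 | i < n].
Proof.
rewrite comp_mpolyX => lb.
under eq_bigr do rewrite tnth_mktuple mnmE.
rewrite /elem_part; elim: lam lb => [|x lam IH] /=.
  by rewrite big_nil big1.
move=> /andP[/andP[x0 xn] /IH]; rewrite big_cons => ->.
under [in RHS]eq_bigr do rewrite exprD.
rewrite big_split /=; congr (_ * _).
have xn' : (x.-1 < n)%N by lia.
rewrite (bigD1 (Ordinal xn')) //= big1 => [|i].
  by rewrite prednK // eqxx expr1 mulr1.
rewrite -val_eqE /= => ix; case: eqP => [xi|]; last by rewrite expr0.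
by move: ix; rewrite xi eqxx.
Qed.

Lemma part_bounds lam : lam \in partitions n -> all (fun i => 0 < i <= n)%N lam.
Proof.
rewrite mem_partitions => /andP[/andP[_ l0] /eqP ln]; apply/allP => x xl.
have := sumn_rem xl; rewrite ln; move: xl l0; case: x => [->|x] //; lia.
Qed.

Lemma part_mnm_inj : {in partitions n &, injective part_mnm}.
Proof.
move=> lam mu hl hm e; have bl := part_bounds hl; have bm := part_bounds hm.
have out (s : seq nat) x : all (fun i => 0 < i <= n)%N s ->
    ~~ (0 < x <= n)%N -> count_mem x s = 0%N.
  by move=> /allP bs xn; apply/count_memPn; apply: contra xn => /bs.
apply: is_part_eq.
- by move: hl; rewrite mem_partitions => /andP[].
- by move: hm; rewrite mem_partitions => /andP[].
rewrite /perm_eq; apply/allP => x _ /=; apply/eqP.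
have [xb|xb] := boolP (0 < x <= n)%N; last by rewrite !out.
have xn : (x.-1 < n)%N by lia.
move/mnmP: e => /(_ (Ordinal xn)); rewrite !mnmE /= prednK //.
by case/andP: xb.
Qed.

End Uniqueness.

(** It suffices to compare the components with N = n = |lam| variables: every part of a partition of
    n is at most n, so all products involved are distinct monomials in e_1, ..., e_n, which are
    algebraically independent in n variables ([msym_fundamental_un]). *)
Lemma e_expansion_uniq F c d lam :
  e_expansion F c -> e_expansion F d -> is_part lam -> c lam = d lam.
Proof.
move=> Fc Fd pl; set n := sumn lam.
have ln : lam \in partitions n by rewrite mem_partitions pl /= eqxx.
have expand b : \sum_(mu <- partitions n) b mu *: elem_part mu n =
    (\sum_(mu <- partitions n) b mu *: 'X_[part_mnm n mu])
      \mPo [tuple mesym n rat i.+1 | i < n].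
  rewrite raddf_sum; apply: eq_big_seq => mu hmu /=.
  by rewrite linearZ /= elem_part_comp // part_bounds.
have coef b : (\sum_(mu <- partitions n) b mu *: 'X_[part_mnm n mu])
    @_(part_mnm n lam) = b lam.
  rewrite raddf_sum (bigD1_seq lam) ?uniq_partitions //= big_seq_cond big1.
    by rewrite mcoeffZ mcoeffX eqxx mulr1 addr0.
  move=> mu /andP[hmu neq]; rewrite mcoeffZ mcoeffX.
  case: eqP => [/part_mnm_inj|]; last by rewrite mulr0.
  by move=> e; rewrite e ?eqxx in neq.
rewrite -[LHS]coef -[RHS]coef; congr (_ @_ _).
by apply: msym_fundamental_un; rewrite -!expand -Fc -Fd.
Qed.

Lemma e_expansion_eq F c d :
  (forall lam, is_part lam -> c lam = d lam) ->
  e_expansion F c -> e_expansion F d.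
Proof.
move=> cd Fc n N; rewrite Fc; apply: eq_big_seq => lam.
by rewrite mem_partitions => /andP[/cd->].
Qed.

Lemma e_expansion_ext F G c :
  (forall n N, F n N = G n N) -> e_expansion F c -> e_expansion G c.
Proof. by move=> FG Fc n N; rewrite -FG Fc. Qed.

Lemma e_expansionD F G c d : e_expansion F c -> e_expansion G d ->
  e_expansion (fun n N => F n N + G n N) (fun lam => c lam + d lam).
Proof.
move=> Fc Gd n N; rewrite Fc Gd -big_split.
by apply: eq_bigr => lam _; rewrite scalerDl.
Qed.

Lemma e_expansionZ F c x : e_expansion F c ->
  e_expansion (fun n N => x *: F n N) (fun lam => x * c lam).
Proof.
move=> Fc n N; rewrite Fc scaler_sumr.
by apply: eq_bigr => lam _; rewrite scalerA.
Qed.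

Lemma e_expansion_one : e_expansion ser_one (fun lam => (size lam == 0%N)%:R).
Proof.
move=> n N; rewrite /ser_one; case: n => [|n].
  by rewrite big_seq1 /= /elem_part big_nil scale1r.
rewrite big_seq big1 // => -[|x s] hs; last by rewrite scale0r.
by move: hs; rewrite mem_partitions.
Qed.

(** * Multiplication by series linear in the e_i *)

Definition ser_lin (h : nat -> rat) : symseries := fun i N => h i *: elem i N.

(** e_lam arises as e_a e_{lam - a} once for each distinct part a, whatever its multiplicity; hence
    [undup]. *)
Definition lin_coef (h : nat -> rat) (c : seq nat -> rat) (lam : seq nat) : rat :=
  \sum_(a <- undup lam) h a * c (rem a lam).

Lemma part_union_rem a lam : is_part lam -> a \in lam ->
  part_union [:: a] (rem a lam) = lam.
Proof.
move=> pl al; apply: is_part_eq => //.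
  apply: is_part_union; last by case/andP: (is_part_rem a pl).
  by rewrite inE; apply: contraTneq al => <-; case/andP: pl.
by rewrite perm_sort perm_sym perm_to_rem.
Qed.

Lemma rem_part_union a mu : (0 < a)%N -> is_part mu ->
  rem a (part_union [:: a] mu) = mu.
Proof.
move=> a0 pm; apply: is_part_eq => //.
  apply/is_part_rem/is_part_union; last by case/andP: pm.
  by rewrite inE; lia.
have au : a \in part_union [:: a] mu by rewrite mem_sort mem_head.
rewrite -(perm_cons a); apply: (@perm_trans _ (part_union [:: a] mu)).
  by rewrite perm_sym perm_to_rem.
by rewrite perm_sort.
Qed.

(* Both lists index the pairs (lam, a) with a in supp(lam), by lam - a or lam. *)
Lemma perm_part_insertions n :
  perm_eq [seq (i, mu) | i <- iota 1 n, mu <- partitions (n - i)]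
          [seq (a, rem a lam) | lam <- partitions n, a <- undup lam].
Proof.
apply: uniq_perm.
- apply: allpairs_uniq_dep => [|i _|]; [exact: iota_uniq|exact: uniq_partitions|].
  by move=> [i mu] [j nu] _ _ /= [-> ->].
- apply: allpairs_uniq_dep => [|lam _|]; first exact: uniq_partitions.
    exact: undup_uniq.
  move=> [l a] [l' a'] /allpairsPdep[lam [b [hl]]] hb [-> ->].
  move=> /allpairsPdep[lam' [b' [hl']]] hb' [-> ->] /= [e e'].
  rewrite e in e' hb *; congr existT.
  move: hl hl' hb hb'; rewrite !mem_partitions !mem_undup.
  move=> /andP[pl _] /andP[pl' _] hb hb'.
  by rewrite -(part_union_rem pl hb) e' part_union_rem.
move=> [i mu]; apply/allpairsPdep/allpairsPdep => -[].
  move=> j [nu []]; rewrite mem_iota mem_partitions => jn /andP[pn /eqP sn] [-> ->].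
  have j0 : (0 < j)%N by lia.
  exists (part_union [:: j] nu), j; split; last by rewrite rem_part_union.
    rewrite mem_partitions is_part_union ?inE //=; last by case/andP: pn.
      by rewrite (perm_sumn (permEl (perm_sort _ _))) /= sn; lia.
    by lia.
  by rewrite mem_undup mem_sort mem_head.
move=> lam [a []]; rewrite mem_partitions mem_undup => /andP[pl /eqP sl] al [-> ->].
have a0 : (0 < a)%N.
  by rewrite lt0n; apply: contraTneq al => ->; case/andP: pl.
have := sumn_rem al; rewrite sl => sr.
exists a, (rem a lam); split=> //; first by rewrite mem_iota; lia.
by rewrite mem_partitions is_part_rem //=; lia.
Qed.

(** Expanding the product gives one term for each pair (a, mu), and regrouping by lam, the union of
    a and mu, is [perm_part_insertions]. A constant term h 0 would not add a part, so it must
    vanish. *)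
Lemma e_expansion_lin_mul h F c : h 0%N = 0 -> e_expansion F c ->
  e_expansion (ser_mul (ser_lin h) F) (lin_coef h c).
Proof.
move=> h0 Fc n N.
pose f (p : nat * seq nat) : {mpoly rat[N]} :=
  (h p.1 * c p.2) *: (elem p.1 N * elem_part p.2 N).
transitivity (\sum_(p <- [seq (i, mu) | i <- iota 1 n, mu <- partitions (n - i)]) f p).
  rewrite big_allpairs_dep /ser_mul big_ord_recl /ser_lin h0 scale0r mul0r add0r.
  rewrite (iotaDl 1 0) big_map -[X in iota 0 X]subn0 big_mkord.
  apply: eq_bigr => i _; rewrite Fc mulr_sumr; apply: eq_bigr => mu _.
  by rewrite /f /= -scalerAl -scalerAr scalerA.
rewrite (perm_big _ (perm_part_insertions n)) big_allpairs_dep /=.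
apply: eq_big_seq => lam; rewrite mem_partitions => /andP[pl _].
rewrite scaler_suml; apply: eq_big_seq => a; rewrite mem_undup => al.
by rewrite /f /= (elem_part_rem N al).
Qed.

Lemma e_expansion_lin h : h 0%N = 0 ->
  e_expansion (ser_lin h) (lin_coef h (fun lam => (size lam == 0%N)%:R)).
Proof.
move=> h0; apply: e_expansion_ext (e_expansion_lin_mul h0 e_expansion_one).
move=> n N; rewrite /ser_mul big_ord_recr /= subnn /ser_one eqxx mulr1.
rewrite big1 ?add0r // => i _; rewrite subn_eq0 leqNgt ltn_ord mulr0 //.
Qed.

(** * The coefficients of the geometric series 1 / (1 - G) *)

Section Epsilon.
Implicit Types s t : seq nat.

Let phi s j : rat := (j%:R - 1) ^+ count_mem j s / (count_mem j s)`!%:R.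

Lemma epsilon_nil : epsilon [::] = 1.
Proof. by rewrite /epsilon big_nil mulr1. Qed.

Lemma epsilon_perm s t : perm_eq s t -> epsilon s = epsilon t.
Proof.
move=> st; rewrite /epsilon (perm_size st) (perm_big _ (perm_undup (perm_mem st))).
by congr (_ * _); apply: eq_bigr => j _; move/permP: st => ->.
Qed.

(** A value of multiplicity zero contributes the factor 1. This lets [s] and [rem a s] be compared
    over the same index set. *)
Lemma epsilon_wide s t : {subset s <= t} ->
  epsilon s = (size s)`!%:R * \prod_(j <- undup t) phi s j.
Proof.
move=> st; rewrite /epsilon; congr (_ * _).
rewrite [RHS](bigID (mem s)) /= [X in _ * X]big1 ?mulr1 => [|j js]; last first.
  by rewrite /phi (count_memPn js) expr0 fact0 divr1.
rewrite -[RHS]big_filter; apply: perm_big; apply: uniq_perm; rewrite ?undup_uniq //.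
  by rewrite filter_uniq ?undup_uniq.
by move=> j; rewrite mem_filter !mem_undup; have [/st->|] := boolP (j \in s).
Qed.

Lemma sum_count_undup s : (\sum_(a <- undup s) count_mem a s)%N = size s.
Proof.
rewrite -[RHS](perm_size (perm_count_undup s)) size_flatten sumnE !big_map.
by apply: eq_bigr => a _; rewrite size_nseq.
Qed.

(** This is 1 / (1 - G) = 1 + G / (1 - G) on coefficients. Removing a part a of multiplicity m gives
    (a-1) epsilon(s - a) = (m / l) epsilon(s) with l the number of parts, and the multiplicities add
    up to l. *)
Lemma epsilon_rec s : (0 < size s)%N ->
  epsilon s = \sum_(a <- undup s) (a%:R - 1) * epsilon (rem a s).
Proof.
move=> s0.
transitivity (\sum_(a <- undup s)
    (count_mem a s)%:R * ((size s).-1`!%:R * \prod_(j <- undup s) phi s j)).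
  rewrite -mulr_suml -natr_sum sum_count_undup mulrA -natrM.
  by rewrite (epsilon_wide (t := s)) // -{1 2}(prednK s0) factS.
apply: eq_big_seq => a; rewrite mem_undup => sa.
rewrite (epsilon_wide (s := rem a s) (t := s)); last by move=> j /mem_rem.
rewrite size_rem // mulrCA [RHS]mulrCA; congr (_ * _).
rewrite !(bigD1_seq a) ?mem_undup ?undup_uniq //= !mulrA; congr (_ * _).
  rewrite /phi.
  have -> : count_mem a s = (count_mem a (rem a s)).+1.
    by rewrite (permP (perm_to_rem sa)) /= eqxx.
  move: (count_mem _ _) => m; rewrite factS natrM exprS.
  have m0 : m.+1%:R != 0 :> rat by rewrite Num.Theory.pnatr_eq0.
  have f0 : m`!%:R != 0 :> rat by rewrite Num.Theory.pnatr_eq0 -lt0n fact_gt0.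
  by field; rewrite f0 nat1r.
apply: eq_bigr => j ja; rewrite /phi (permP (perm_to_rem sa)) /=.
by rewrite eq_sym (negPf ja).
Qed.

End Epsilon.

(** * Words without equal adjacent letters *)

Section Cauchy.
Variable R : comNzRingType.
Implicit Types (f g h : nat -> R) (p q : {poly R}).

Definition cauchy f g n : R := \sum_(i < n.+1) f i * g (n - i)%N.

Lemma eq_cauchy f f' g g' : f =1 f' -> g =1 g' -> cauchy f g =1 cauchy f' g'.
Proof. by move=> ff gg n; apply: eq_bigr => i _; rewrite ff gg. Qed.

Lemma cauchy_poly p q n : cauchy (nth 0 p) (nth 0 q) n = (p * q)`_n.
Proof. by rewrite coefM. Qed.

(** Truncation to polynomials does not change coefficients below the cut, so commutativity and
    associativity are inherited from [{poly R}]. *)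
Lemma cauchyE f g n m : (n < m)%N ->
  cauchy f g n = (\poly_(i < m) f i * \poly_(i < m) g i)`_n.
Proof.
move=> nm; rewrite coefM; apply: eq_bigr => i _; rewrite !coef_poly.
by rewrite !ifT //; case: i => i /=; lia.
Qed.

Lemma cauchyC f g n : cauchy f g n = cauchy g f n.
Proof. by rewrite !(cauchyE _ _ (ltnSn n)) mulrC. Qed.

Lemma cauchyA f g h n : cauchy f (cauchy g h) n = cauchy (cauchy f g) h n.
Proof.
pose P u := \poly_(i < n.+1) u i : {poly R}.
have PE u i : (i <= n)%N -> u i = (P u)`_i by move=> ?; rewrite coef_poly ltnS ifT.
transitivity (P f * (P g * P h))`_n.
  rewrite coefM; apply: eq_bigr => i _.
  by rewrite -PE ?(cauchyE _ _ (m := n.+1)) //; case: i => i /=; lia.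
rewrite mulrA coefM; apply: eq_bigr => i _.
by rewrite -PE ?(cauchyE _ _ (m := n.+1)) //; case: i => i /=; lia.
Qed.

Lemma cauchyDl f g h n : cauchy (fun i => f i + g i) h n = cauchy f h n + cauchy g h n.
Proof. by rewrite -big_split; apply: eq_bigr => i _; rewrite mulrDl. Qed.

Lemma cauchyBl f g h n : cauchy (fun i => f i - g i) h n = cauchy f h n - cauchy g h n.
Proof. by rewrite -sumrB; apply: eq_bigr => i _; rewrite mulrBl. Qed.

Lemma cauchy_suml (I : finType) (f : I -> nat -> R) h n :
  cauchy (fun i => \sum_a f a i) h n = \sum_a cauchy (f a) h n.
Proof. by rewrite exchange_big; apply: eq_bigr => i _; rewrite mulr_suml. Qed.

Lemma cauchy1l h n : cauchy (fun i => (i == 0%N)%:R) h n = h n.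
Proof.
by rewrite /cauchy big_ord_recl /= mul1r subn0 big1 ?addr0 // => i _; rewrite mul0r.
Qed.

Lemma cauchyDr f g h n : cauchy h (fun i => f i + g i) n = cauchy h f n + cauchy h g n.
Proof. by rewrite !(cauchyC h) cauchyDl. Qed.

Lemma cauchy_sumr (I : finType) (f : I -> nat -> R) h n :
  cauchy h (fun i => \sum_a f a i) n = \sum_a cauchy h (f a) n.
Proof. by rewrite cauchyC cauchy_suml; apply: eq_bigr => a _; rewrite cauchyC. Qed.

Lemma cauchy1r h n : cauchy h (fun i => (i == 0%N)%:R) n = h n.
Proof. by rewrite cauchyC cauchy1l. Qed.

(* (1 - g) is invertible when g has no constant term. *)
Lemma cauchy_fixpoint_uniq e g f f' : g 0%N = 0 ->
  (forall n, f n = e n + cauchy g f n) ->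
  (forall n, f' n = e n + cauchy g f' n) -> f =1 f'.
Proof.
move=> g0 fE fE' n; elim/ltn_ind: n => n IH.
rewrite fE fE' /cauchy !big_ord_recl g0 !mul0r; congr (_ + (_ + _)).
by apply: eq_bigr => i _; rewrite IH // lift0; case: i => i /=; lia.
Qed.

End Cauchy.

Lemma deriv_prod_seq (R : comNzRingType) (I : eqType) (F : I -> {poly R}) (s : seq I) :
  uniq s -> (\prod_(i <- s) F i)^`() =
  \sum_(a <- s) (F a)^`() * \prod_(b <- s | b != a) F b.
Proof.
elim: s => [|x s IH] /=; first by rewrite !big_nil derivC.
move=> /andP[xs us]; rewrite !big_cons derivM IH // eqxx /=; congr (_ * _ + _).
  rewrite [RHS]big_seq_cond [LHS]big_seq; apply: eq_bigl => b.
  by case: eqVneq => [->|]; rewrite ?andbT // (negPf xs).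
rewrite mulr_sumr; apply: eq_big_seq => a sa.
rewrite big_cons ifT; first by rewrite mulrCA.
by apply: contraNneq xs => ->.
Qed.

(* Here W n enumerates words of length n without equal adjacent letters, and  *)
(* Wa a those starting with a.                                                *)
Section SmirnovWords.
Variables (R : comNzRingType) (I : finType) (x : I -> R).
Variables (W : nat -> R) (Wa : I -> nat -> R).
Hypothesis Wa0 : forall a, Wa a 0%N = 0.
Hypothesis WaS : forall a n, Wa a n.+1 = x a * (W n - Wa a n).
Hypothesis WE : forall n, W n = (n == 0%N)%:R + \sum_a Wa a n.

Let E := \prod_a (x a *: 'X + 1).

(** [WaS] says (1 + x_a z) W_a = x_a z W. Multiplying by the other factors of E gives E W_a = E_a
    x_a z W, where E_a omits the factor of a. Summed over a, the right side is z E' W by the product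
    rule, while [WE] makes the left side E W - E. *)
Lemma smirnov_words n : cauchy (nth 0 (E - 'X * E^`())) W n = E`_n.
Proof.
pose Ea a := \prod_(b | b != a) (x b *: 'X + 1).
have EEa a : E = Ea a * (x a *: 'X + 1) by rewrite /E (bigD1 a) //= mulrC.
have dE : 'X * E^`() = \sum_a Ea a * (x a *: 'X).
  rewrite deriv_prod_seq ?index_enum_uniq // mulr_sumr; apply: eq_bigr => a _.
  by rewrite derivD derivZ derivX derivC addr0 mulrA mulrC -scalerAr mulr1.
have step a m : cauchy (nth 0 (x a *: 'X + 1)) (Wa a) m = cauchy (nth 0 (x a *: 'X)) W m.
  have two f c : cauchy (nth 0 (x a *: 'X + c%:P)) f m =
      c * f m + (if m is m'.+1 then x a * f m' else 0).
    rewrite /cauchy big_ord_recl /= coefD coefZ coefX mulr0 add0r coefC eqxx subn0.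
    congr (_ + _); case: m => [|m]; first by rewrite big_ord0.
    rewrite big_ord_recl big1 => [|i _].
      by rewrite coefD coefZ coefX coefC /= mulr1 !addr0 subn1.
    by rewrite coefD coefZ coefX coefC /= mulr0 addr0 mul0r.
  have := two (Wa a) 1; have := two W 0.
  rewrite polyC0 polyC1 addr0 mul0r mul1r add0r => -> ->.
  case: m {two} => [|m]; first by rewrite Wa0 addr0.
  by rewrite WaS mulrBr subrK.
have main a m : cauchy (nth 0 E) (Wa a) m = cauchy (nth 0 (Ea a * (x a *: 'X))) W m.
  rewrite (EEa a).
  transitivity (cauchy (nth 0 (Ea a)) (cauchy (nth 0 (x a *: 'X + 1)) (Wa a)) m).
    by rewrite cauchyA; apply: eq_cauchy => // i; rewrite cauchy_poly.
  transitivity (cauchy (nth 0 (Ea a)) (cauchy (nth 0 (x a *: 'X)) W) m).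
    by apply: eq_cauchy => // i; exact: step.
  by rewrite cauchyA; apply: eq_cauchy => // i; rewrite cauchy_poly.
rewrite (eq_cauchy (f' := fun i => E`_i - ('X * E^`())`_i) (g' := W)) //; last first.
  by move=> i; rewrite coefB.
rewrite cauchyBl.
rewrite (eq_cauchy (f' := nth 0 E) (g' := fun i => (i == 0%N)%:R + \sum_a Wa a i)) //.
rewrite cauchyDr cauchy1r cauchy_sumr dE.
under eq_bigr do rewrite main.
rewrite -cauchy_suml -[RHS]addr0 -addrA; congr (_ + _).
by apply/eqP; rewrite subr_eq0; apply/eqP/eq_cauchy => // i; rewrite coef_sum.
Qed.

End SmirnovWords.

Lemma coef_prod_elem N k :
  (\prod_(i < N) ('X_i *: 'X + 1) : {poly {mpoly rat[N]}})`_k = elem k N.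
Proof.
rewrite bigA_distr coef_sum /elem /mesym [RHS]big_mkcond /=.
apply: eq_bigr => J _; rewrite -big_mkcond scaler_prod prodr_const coefZ coefXn.
by rewrite eq_sym; case: ifP; rewrite ?mulr1 ?mulr0.
Qed.

(** * Proper colorings of paths and twinned paths *)

Lemma proper_coloringP (H : sgraph) N (k : {ffun H -> 'I_N}) :
  reflect (forall x y, adj x y -> k x != k y) (proper_coloring k).
Proof.
apply: (iffP forallP) => [kP x y|kP x]; first by move/forallP: (kP x) => /(_ y)/implyP.
by apply/forallP => y; apply/implyP/kP.
Qed.

Lemma chromsym_iso (H K : sgraph) (f : H -> K) (g : K -> H) N :
  cancel f g -> cancel g f -> (forall x y, adj (f x) (f y) = adj x y) ->
  chromsym H N = chromsym K N.
Proof.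
move=> fK gK fadj; rewrite /chromsym.
rewrite [RHS](reindex (fun k : {ffun H -> 'I_N} => [ffun y => k (g y)])) /=; last first.
  exists (fun k : {ffun K -> 'I_N} => [ffun x => k (f x)]) => k _;
    by apply/ffunP => z; rewrite !ffunE ?fK ?gK.
apply: eq_big => [k|k _].
  apply/proper_coloringP/proper_coloringP => kP x y.
    by rewrite !ffunE -{1}(gK x) -{1}(gK y) fadj => /kP.
  by rewrite -fadj => /kP; rewrite !ffunE !fK.
rewrite (reindex g) /=; last by exists f => z _; rewrite ?fK ?gK.
by apply: eq_bigr => x _; rewrite ffunE.
Qed.

(** Reversing the path exchanges its ends, so only the twin at the first vertex needs study. *)
Lemma twin_path_end n (u : path_graph n.+1) N : path_end u ->
  chromsym (twin u) N = chromsym (twin (ord0 : path_graph n.+1)) N.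
Proof.
move=> /orP[/eqP->//|/eqP->].
pose f (o : option 'I_n.+1) := omap (@rev_ord _) o.
have fK : cancel f f by case=> [i|] //=; rewrite rev_ordK.
apply: (@chromsym_iso (twin (ord_max : path_graph n.+1))
  (twin (ord0 : path_graph n.+1)) f f) => // -[i|] [j|] //=; rewrite /path_adj -?val_eqE /=.
- by case: i j => [i Hi] [j Hj] /=; lia.
- by case: i => [i Hi] /=; lia.
by case: j => [j Hj] /=; lia.
Qed.

Section Colorings.
Variable N : nat.

Definition ocons (T : finType) (a : 'I_N) (k : {ffun T -> 'I_N}) :
    {ffun option T -> 'I_N} :=
  [ffun o => if o is Some x then k x else a].

Definition fcons n (a : 'I_N) (k : {ffun 'I_n -> 'I_N}) : {ffun 'I_n.+1 -> 'I_N} :=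
  [ffun i => if unlift ord0 i is Some j then k j else a].

Lemma fcons0 n a (k : {ffun 'I_n -> 'I_N}) : fcons a k ord0 = a.
Proof. by rewrite ffunE unlift_none. Qed.

Lemma fconsS n a (k : {ffun 'I_n -> 'I_N}) i : fcons a k (lift ord0 i) = k i.
Proof. by rewrite ffunE liftK. Qed.

Section BigCons.
Variables (R : nmodType).

Lemma big_ocons (T : finType) (F : {ffun option T -> 'I_N} -> R) :
  \sum_k F k = \sum_a \sum_k F (ocons a k).
Proof.
rewrite pair_big (reindex (fun p => ocons p.1 p.2)) //=.
exists (fun k => (k None, [ffun x => k (Some x)])).
  by move=> [a k] _; rewrite ffunE; congr pair; apply/ffunP => x; rewrite !ffunE.
by move=> k _; apply/ffunP => -[x|]; rewrite !ffunE.
Qed.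

Lemma big_fcons n (F : {ffun 'I_n.+1 -> 'I_N} -> R) :
  \sum_k F k = \sum_a \sum_k F (fcons a k).
Proof.
rewrite pair_big (reindex (fun p => fcons p.1 p.2)) //=.
exists (fun k => (k ord0, [ffun x => k (lift ord0 x)])).
  by move=> [a k] _; rewrite fcons0; congr pair; apply/ffunP => x; rewrite ffunE fconsS.
by move=> k _; apply/ffunP => i; rewrite !ffunE; case: unliftP => [j ->|->] //; rewrite ffunE.
Qed.

End BigCons.

Lemma prod_ocons (T : finType) a (k : {ffun T -> 'I_N}) :
  \prod_o 'X_(ocons a k o) = 'X_a * \prod_x 'X_(k x) :> {mpoly rat[N]}.
Proof.
rewrite (bigD1 None) //= ffunE; congr (_ * _).
rewrite (reindex_omap Some id) /=; last by case.
by apply: eq_big => [x|x _]; rewrite ?eqxx // ffunE.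
Qed.

Lemma prod_fcons n a (k : {ffun 'I_n -> 'I_N}) :
  \prod_o 'X_(fcons a k o) = 'X_a * \prod_x 'X_(k x) :> {mpoly rat[N]}.
Proof.
by rewrite big_ord_recl fcons0; congr (_ * _); apply: eq_bigr => i _; rewrite fconsS.
Qed.

Definition proper_path n (k : {ffun 'I_n -> 'I_N}) : bool :=
  @proper_coloring (path_graph n) N k.

Lemma proper_path_small n (k : {ffun 'I_n -> 'I_N}) : (n < 2)%N -> proper_path k.
Proof.
move=> n2; apply/proper_coloringP => -[i Hi] [j Hj] /=; rewrite /path_adj /=; lia.
Qed.

Lemma path_adj_lift n (x y : 'I_n) :
  path_adj (lift ord0 x) (lift ord0 y) = path_adj x y.
Proof. by rewrite /path_adj !lift0 !eqSS. Qed.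

Lemma path_adj_ord0 n (x : 'I_n.+1) : path_adj ord0 (lift ord0 x) = (x == ord0).
Proof. by rewrite /path_adj !lift0 eqSS orbF eq_sym. Qed.

Lemma proper_path_cons n a (k : {ffun 'I_n.+1 -> 'I_N}) :
  proper_path (fcons a k) = (a != k ord0) && proper_path k.
Proof.
apply/proper_coloringP/andP => [kP|[ak /proper_coloringP kP] x y].
  split.
    by rewrite -(fcons0 a k) -(fconsS a k); apply: kP; rewrite [adj _ _]path_adj_ord0.
  apply/proper_coloringP => x y xy; rewrite -2!(fconsS a k); apply: kP.
  by rewrite [adj _ _]path_adj_lift.
case: (unliftP ord0 x) (unliftP ord0 y) => [i ->|->] [j ->|->]; rewrite ?fcons0 ?fconsS.
- by rewrite [adj _ _]path_adj_lift => /kP.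
- by rewrite [adj _ _]path_adj_sym path_adj_ord0 => /eqP->; rewrite eq_sym.
- by rewrite [adj _ _]path_adj_ord0 => /eqP->.
by rewrite adj_irr.
Qed.

Lemma proper_twin_single a b (k : {ffun 'I_0 -> 'I_N}) :
  @proper_coloring (twin (ord0 : path_graph 1)) N (ocons b (fcons a k)) = (a != b).
Proof.
apply/proper_coloringP/idP => [kP|ab].
  by have := kP (Some ord0) None isT; rewrite !ffunE unlift_none.
by case=> [x|] [y|] //=; rewrite !ord1 !ffunE ?unlift_none // eq_sym.
Qed.

Lemma proper_twin_cons n a b (k : {ffun 'I_n.+1 -> 'I_N}) :
  @proper_coloring (twin (ord0 : path_graph n.+2)) N (ocons b (fcons a k)) =
  [&& a != b, a != k ord0, b != k ord0 & proper_path k].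
Proof.
have -> : [&& a != b, a != k ord0, b != k ord0 & proper_path k] =
    [&& a != b, b != k ord0 & proper_path (fcons a k)].
  by rewrite proper_path_cons; congr (_ && _); rewrite andbCA.
apply/proper_coloringP/and3P => [kP|[ab bk /proper_coloringP kP]].
  split.
  - by have := kP (Some ord0) None isT; rewrite !ffunE unlift_none.
  - by have := kP None (Some (lift ord0 ord0)) isT; rewrite !ffunE liftK.
  apply/proper_coloringP => x y xy.
  by have := kP (Some x) (Some y) xy; rewrite !ffunE.
have end1 x : (x == ord0) || path_adj ord0 x -> b != fcons a k x.
  case: (unliftP ord0 x) => [i ->|->]; rewrite ?fcons0 ?fconsS; last by rewrite eq_sym.
  by rewrite path_adj_ord0 /= => /eqP->.
case=> [x|] [y|] //= xy; rewrite [ocons _ _ _]ffunE [X in _ != X]ffunE.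
- exact: kP.
- by rewrite eq_sym; apply: end1.
- exact: end1.
Qed.

Let X (a : 'I_N) : {mpoly rat[N]} := 'X_a.

(** Plays the role of [Wa]; the value at 0 is 0 because the empty word has no first letter. *)
Definition path_from n (a : 'I_N) : {mpoly rat[N]} :=
  if n is n'.+1 then
    \sum_(k : {ffun 'I_n'.+1 -> 'I_N} | proper_path k && (k ord0 == a)) \prod_i 'X_(k i)
  else 0.

Lemma ffun_ord0_eq (k l : {ffun 'I_0 -> 'I_N}) : k = l.
Proof. by apply/ffunP => -[]. Qed.

Lemma big_ffun_ord0 (R : nmodType) (F : {ffun 'I_0 -> 'I_N} -> R) :
  \sum_k F k = F (ffun0 (card_ord 0)).
Proof. by rewrite (big_pred1 (ffun0 (card_ord 0))) // => k; apply/esym/eqP/ffun_ord0_eq. Qed.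

Lemma chromsym_path n :
  chromsym (path_graph n) N = (n == 0%N)%:R + \sum_a path_from n a.
Proof.
case: n => [|n] /=.
  rewrite [X in _ + X]big1 // addr0 /chromsym big_mkcond big_ffun_ord0.
  by rewrite [proper_coloring _](@proper_path_small 0) // big_ord0.
by rewrite add0r /chromsym
     (partition_big (fun k : {ffun 'I_n.+1 -> 'I_N} => k ord0) predT).
Qed.

Lemma path_from_cons n a : path_from n.+1 a =
  X a * \sum_(k : {ffun 'I_n -> 'I_N} | proper_path (fcons a k)) \prod_i 'X_(k i).
Proof.
rewrite /path_from big_mkcond big_fcons (bigD1 a) //= [X in _ + X]big1 ?addr0.
  rewrite mulr_sumr [RHS]big_mkcond; apply: eq_bigr => k _.
  by rewrite fcons0 eqxx andbT prod_fcons.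
by move=> b ba; rewrite big1 // => k _; rewrite fcons0 (negPf ba) andbF.
Qed.

(** After the first letter a comes any proper word that does not start with a. *)
Lemma path_fromS n a :
  path_from n.+1 a = X a * (chromsym (path_graph n) N - path_from n a).
Proof.
rewrite path_from_cons; congr (_ * _); case: n => [|n].
  by rewrite /chromsym subr0; apply: eq_bigl => k; rewrite !(proper_path_small k,
    proper_path_small (fcons a k)) // [RHS](proper_path_small k).
rewrite /chromsym.
rewrite [X in _ = X - _](bigID (fun k : {ffun 'I_n.+1 -> 'I_N} => k ord0 == a)) /=.
rewrite [X in X + _ - _](_ : _ = path_from n.+1 a) // addrAC subrr add0r.
by apply: eq_bigl => k; rewrite proper_path_cons andbC eq_sym.
Qed.

Lemma sum_neq (R : zmodType) (f : 'I_N -> R) b :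
  \sum_(a | a != b) f a = \sum_a f a - f b.
Proof. by rewrite [X in X - _](bigD1 b) //= addrC addrK. Qed.

(** Here a and b color the first vertex and its twin. The remaining path may start with neither, and
    since a and b differ, the two excluded families of words are disjoint and can be subtracted
    separately. *)
Lemma chromsym_twin_sum n :
  chromsym (twin (ord0 : path_graph n.+1)) N =
  \sum_b \sum_(a | a != b)
    X b * (X a * (chromsym (path_graph n) N - path_from n a - path_from n b)).
Proof.
rewrite /chromsym big_mkcond (big_ocons (T := 'I_n.+1)).
apply: eq_bigr => b _; rewrite big_fcons [RHS]big_mkcond; apply: eq_bigr => a _.
under eq_bigr do rewrite prod_ocons prod_fcons.
case: n => [|n].
  under eq_bigr do rewrite proper_twin_single.
  case: ifP => ab; last by rewrite big1.
  rewrite -!mulr_sumr !subr0; congr (_ * (_ * _)).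
  by apply: eq_bigl => k; apply/esym/(proper_path_small k).
under eq_bigr do rewrite proper_twin_cons.
case: (boolP (a != b)) => ab /=; last by rewrite big1.
rewrite -big_mkcond /= -!mulr_sumr; congr (_ * (_ * _)).
rewrite [X in _ = X - _ - _](bigID (fun k : {ffun 'I_n.+1 -> 'I_N} => k ord0 == a)) /=.
rewrite [X in X + _ - _ - _](_ : _ = path_from n.+1 a) // [X in X - _ - _]addrC addrK.
rewrite [X in _ = X - _](bigID (fun k : {ffun 'I_n.+1 -> 'I_N} => k ord0 == b)) /=.
rewrite [X in X + _ - _](_ : _ = path_from n.+1 b); last first.
  apply: eq_bigl => k; rewrite -andbA; congr (_ && _).
  by case: (k ord0 =P b) => [->|]; rewrite ?andbF // andbT eq_sym ab.
rewrite addrAC subrr add0r; apply: eq_bigl => k.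
by rewrite -!(eq_sym (k ord0)) andbA andbC andbA.
Qed.

(* Triple deletion: for a <> b, the condition c <> a, b has indicator         *)
(* [c <> a] + [c <> b] - 1.                                                   *)
Lemma chromsym_twin n :
  chromsym (twin (ord0 : path_graph n.+1)) N =
  2 * chromsym (path_graph n.+2) N -
    chromsym (path_graph 2) N * chromsym (path_graph n) N.
Proof.
have PS m : chromsym (path_graph m.+1) N = \sum_a path_from m.+1 a.
  by rewrite chromsym_path add0r.
have P0 : chromsym (path_graph 0) N = 1.
  by rewrite chromsym_path big1 ?addr0.
have T m : \sum_b \sum_(a | a != b) X b * path_from m.+1 a =
    chromsym (path_graph m.+2) N.
  rewrite PS; apply: eq_bigr => b _.
  by rewrite -mulr_sumr sum_neq -PS -path_fromS.
rewrite chromsym_twin_sum.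
under eq_bigr => b _.
  under eq_bigr => a ab.
    (* Since [path_from 1 a] is [X a], summing over a <> b turns the first two terms into two copies
       of the path on n + 2 vertices, and the last into the product of the paths on 2 and n
       vertices. *)
    rewrite (_ : X b * _ = X b * path_from n.+1 a + X a * path_from n.+1 b
      - X b * path_from 1 a * chromsym (path_graph n) N); last first.
      rewrite !path_fromS P0 subr0; ring.
    over.
  rewrite sumrB big_split /=.
  over.
rewrite sumrB big_split /= T (exchange_big_dep predT) //=.
under [X in _ + X - _]eq_bigr do under eq_bigl do rewrite eq_sym.
rewrite T -mulr2n mulr_natl; congr (_ - _).
by rewrite -T mulr_suml; apply: eq_bigr => b _; rewrite mulr_suml.
Qed.

End Colorings.

(** With x_a the variables, E is the series of the e_i and E - z E' has coefficients (1-i) e_i, so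
    it is 1 - G and [smirnov_words] reads (1 - G) P = E. *)
Lemma path_series_rec n N :
  chromsym (path_graph n) N = elem n N +
    cauchy (fun i => serG i N) (fun i => chromsym (path_graph i) N) n.
Proof.
have := @smirnov_words _ _ (fun a : 'I_N => 'X_a) (fun i => chromsym (path_graph i) N)
  (fun a i => path_from i a) (fun a => erefl) (fun a n => path_fromS n a)
  (fun n => chromsym_path N n) n.
rewrite coef_prod_elem => <-.
rewrite (eq_cauchy (f' := fun i => (i == 0%N)%:R - serG i N)
  (g' := fun i => chromsym (path_graph i) N)) //; last first.
  case=> [|i]; rewrite coefB coefXM /= ?coef_deriv !coef_prod_elem /serG.
    by rewrite /elem mesym0E.
  case: i => [|i]; first by rewrite mulr1n subrr subr0.
  by rewrite sub0r scalerBl scale1r opprB scaler_nat.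
by rewrite cauchyBl cauchy1l subrK.
Qed.

(** * Coefficients of the twinned path series *)

Definition natG (a : nat) : rat := if (2 <= a)%N then a%:R - 1 else 0.
Definition natG3 (a : nat) : rat := if (3 <= a)%N then a%:R - 1 else 0.
Definition natK (a : nat) : rat := if (2 <= a)%N then a%:R else 0.

Lemma ser_mulE F G n N :
  ser_mul F G n N = cauchy (fun i => F i N) (fun i => G i N) n.
Proof. by []. Qed.

Lemma ser_linE (h : nat -> rat) (P : pred nat) i N :
  ser_lin (fun a => if P a then h a else 0) i N = if P i then h i *: elem i N else 0.
Proof. by rewrite /ser_lin; case: ifP; rewrite ?scale0r. Qed.

Lemma eq_lin_coef h h' c c' lam :
  (forall a, a \in lam -> h a * c (rem a lam) = h' a * c' (rem a lam)) ->
  lin_coef h c lam = lin_coef h' c' lam.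
Proof. by move=> e; apply: eq_big_seq => a; rewrite mem_undup => /e. Qed.

Lemma lin_coef_eq0 h c lam :
  (forall a, a \in lam -> h a * c (rem a lam) = 0) -> lin_coef h c lam = 0.
Proof. by move=> e; rewrite /lin_coef big_seq big1 // => a; rewrite mem_undup => /e. Qed.

Lemma perm_rem (a : nat) s t : perm_eq s t -> perm_eq (rem a s) (rem a t).
Proof.
move=> st; have [sa|sa] := boolP (a \in s); last by rewrite !rem_id // -(perm_mem st).
rewrite -(perm_cons a) -(permPl (perm_to_rem sa)) (permPl st).
by apply: perm_to_rem; rewrite -(perm_mem st).
Qed.

Lemma lin_coef_perm h c :
  (forall s t, perm_eq s t -> c s = c t) ->
  forall s t, perm_eq s t -> lin_coef h c s = lin_coef h c t.
Proof.
move=> cP s t st; rewrite /lin_coef (perm_big _ (perm_undup (perm_mem st))).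
by apply: eq_bigr => a _; congr (_ * _); apply/cP/perm_rem.
Qed.

Lemma lin_coef_cons1 h c s : h 1%N = 0 ->
  lin_coef h c (1%N :: s) = lin_coef h (fun t => c (1%N :: t)) s.
Proof.
move=> h1; rewrite /lin_coef /=.
have rem1 a : h a * c (rem a (1%N :: s)) = h a * c (1%N :: rem a s).
  by rewrite /=; case: eqP => [<-|//]; rewrite h1 !mul0r.
case: ifP => _; rewrite ?big_cons ?h1 ?mul0r ?add0r; apply: eq_bigr => a _; exact: rem1.
Qed.

Lemma lin_coef1 h c a : lin_coef h c [:: a] = h a * c [::].
Proof. by rewrite /lin_coef big_seq1 /= eqxx. Qed.

Lemma lin_coef2 h c i j : i != j ->
  lin_coef h c [:: i; j] = h i * c [:: j] + h j * c [:: i].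
Proof.
move=> ij; rewrite /lin_coef /= inE (negPf ij) big_cons big_seq1 /= !eqxx.
by rewrite (negPf ij).
Qed.

Lemma lin_coef_nseq h c k a : lin_coef h c (nseq k.+1 a) = h a * c (nseq k a).
Proof.
rewrite /lin_coef (_ : undup _ = [:: a]) ?big_seq1 /= ?eqxx //.
elim: k => [|k IH] //=; rewrite inE eqxx /=.
exact: IH.
Qed.

Lemma epsilon_eq0 s : 1%N \in s -> epsilon s = 0.
Proof.
move=> s1; rewrite /epsilon (bigD1_seq 1%N) ?mem_undup ?undup_uniq //=.
rewrite subrr expr0n -leqn0 leqNgt -has_count has_pred1 s1 /=.
by rewrite !mul0r mulr0.
Qed.

Lemma epsilon_nseq2 k : epsilon (nseq k 2%N) = 1.
Proof.
elim: k => [|k IH]; first exact: epsilon_nil.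
have := lin_coef_nseq (fun a => a%:R - 1) epsilon k 2; rewrite IH => /= e.
by rewrite epsilon_rec // [LHS]e; ring.
Qed.

(** [natG] differs from a - 1 only at a = 0, where it is 0 instead of -1. *)
Lemma epsilon_lin_coef s : 0%N \notin s -> (0 < size s)%N ->
  epsilon s = lin_coef natG epsilon s.
Proof.
move=> s0 sz; rewrite epsilon_rec //; apply: eq_lin_coef => -[|[|a]] // sa.
by rewrite sa in s0.
Qed.

Lemma epsilon_sub2C s a b : a \in s -> b \in s ->
  epsilon_sub2 s a b = if a \in rem b s then epsilon (rem a (rem b s)) else 0.
Proof.
move=> sa sb; rewrite /epsilon_sub2 sa /=.
have memC x y : y \in s -> x \in s -> x \in rem y s -> y \in rem x s.
  move=> sy sx; have [<-//|xy] := eqVneq x y => _.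
  by move: sy; rewrite (perm_mem (perm_to_rem sx)) inE eq_sym (negPf xy).
have -> : (b \in rem a s) = (a \in rem b s) by apply/idP/idP => /memC; apply.
case: ifP => // ab; apply: epsilon_perm; rewrite -(perm_cons b) -(perm_cons a).
have ba := memC _ _ sb sa ab.
apply: (@perm_trans _ s).
  by rewrite perm_sym (perm_trans (perm_to_rem sa)) // perm_cons perm_to_rem.
apply: (@perm_trans _ [:: b, a & rem a (rem b s)]).
  by rewrite (perm_trans (perm_to_rem sb)) // perm_cons perm_to_rem.
exact: permEl (perm_catCA [:: b] [:: a] _).
Qed.

(** The outer operator removes b and the inner one then removes a from the support of s - b. The
    zero convention of [epsilon_sub2] extends the inner sum to the whole support, and
    [epsilon_sub2C] exchanges the order of removal. *)
Lemma lin_coef_sub2 h g s :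
  lin_coef h (lin_coef g epsilon) s =
  \sum_(a <- undup s) \sum_(b <- undup s) g a * h b * epsilon_sub2 s a b.
Proof.
rewrite exchange_big; apply: eq_big_seq => b; rewrite mem_undup => sb.
rewrite [RHS](bigID (mem (rem b s))) /= [X in _ + X]big_seq_cond [X in _ + X]big1.
  rewrite addr0 /lin_coef mulr_sumr -[RHS]big_filter.
  rewrite (perm_big [seq a <- undup s | a \in rem b s]) /=.
    apply: eq_big_seq => a; rewrite mem_filter mem_undup => /andP[ab sa].
    by rewrite epsilon_sub2C // ab; ring.
  apply: uniq_perm; rewrite ?filter_uniq ?undup_uniq // => a.
  by rewrite mem_filter !mem_undup; case: (boolP (a \in _)) => // /mem_rem->.
move=> a /andP[]; rewrite mem_undup => sa ab.
by rewrite epsilon_sub2C // (negPf ab) mulr0.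
Qed.

Definition serP : symseries := fun n => chromsym (path_graph n).

Definition path_coef (lam : seq nat) : rat :=
  (size lam == 0%N)%:R + lin_coef (fun a => a%:R) epsilon lam.

(* P = E / (1 - G) = 1 + (e_1 z + K) / (1 - G), and epsilon gives 1 / (1 - G). *)
Lemma e_expansion_path : e_expansion serP path_coef.
Proof.
pose Q : symseries := fun n N => \sum_(lam <- partitions n) epsilon lam *: elem_part lam N.
have eQ : e_expansion Q epsilon by [].
(* The recursion for epsilon says Q = 1 + G Q; hence E Q solves the same fixpoint equation as P. *)
have QG n N : Q n N = (n == 0%N)%:R + cauchy (fun i => serG i N) (fun i => Q i N) n.
  have := e_expansionD e_expansion_one (e_expansion_lin_mul (h := natG) erefl eQ).
  move=> /(_ n N) e; transitivity (\sum_(lam <- partitions n)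
      ((size lam == 0%N)%:R + lin_coef natG epsilon lam) *: elem_part lam N).
    apply: eq_big_seq => lam; rewrite mem_partitions => /andP[/andP[_ l0] _].
    case: lam l0 => [|a lam] l0; last by rewrite add0r -epsilon_lin_coef.
    by rewrite epsilon_nil /lin_coef big_nil addr0.
  by rewrite -e ser_mulE; congr (_ + _); apply: eq_cauchy => // i; apply: ser_linE.
have PE n N : serP n N = cauchy (fun i => elem i N) (fun i => Q i N) n.
  apply: (@cauchy_fixpoint_uniq _ (fun i => elem i N) (fun i => serG i N)
    (fun i => serP i N) (cauchy (fun i => elem i N) (fun i => Q i N))) => //.
    by move=> m; rewrite /serP path_series_rec.
  move=> m; rewrite cauchyA.
  transitivity (cauchy (fun i => elem i N)
    (fun i => (i == 0%N)%:R + cauchy (fun i => serG i N) (fun i => Q i N) i) m).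
    by apply: eq_cauchy => // i; apply: QG.
  rewrite cauchyDr cauchy1r cauchyA; congr (_ + _).
  by apply: eq_cauchy => // i; rewrite cauchyC.
(* Writing E Q = Q + (E - 1) Q and unfolding epsilon in the first summand gives each part the weight
   (a-1) + 1 = a. *)
pose h (a : nat) : rat := (0 < a)%:R.
have e := e_expansionD eQ (e_expansion_lin_mul (h := h) erefl eQ).
apply: (e_expansion_eq _ (e_expansion_ext _ e)) => [lam /andP[_ l0]|n N].
  rewrite /path_coef; case: lam l0 => [|a lam] l0.
    by rewrite epsilon_nil /lin_coef !big_nil.
  rewrite add0r {1}epsilon_lin_coef // -big_split; apply: eq_big_seq => b.
  rewrite mem_undup => bl; rewrite /= -mulrDl; congr (_ * _).
  case: b bl l0 => [->//|[|b]] _ _; rewrite /natG /h /=; ring.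
rewrite PE.
transitivity (cauchy (fun i => (i == 0%N)%:R + ser_lin h i N) (fun i => Q i N) n).
  by rewrite cauchyDl cauchy1l.
apply: eq_cauchy => // -[|i]; rewrite /ser_lin /h ?scale0r ?scale1r ?addr0 ?add0r //.
by rewrite /elem mesym0E.
Qed.

Definition twin_coef (lam : seq nat) : rat :=
  2 * (lin_coef (fun a => (2 <= a)%:R) (fun s => (size s == 0%N)%:R) lam +
       lin_coef natG3 path_coef lam).

(* F = 2 (E_{>=2} + G_{>=3} P), since P = E + G P and G = e_2 z^2 + G_{>=3}. *)
Lemma e_expansion_twin (v : forall n : nat, path_graph n.+1) :
  (forall n : nat, path_end (v n)) -> e_expansion (serXPv v) twin_coef.
Proof.
move=> v_end.
have := e_expansionZ 2 (e_expansionD (e_expansion_lin (h := fun a => (2 <= a)%:R) erefl)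
  (e_expansion_lin_mul (h := natG3) erefl e_expansion_path)).
apply: e_expansion_ext => n N.
rewrite [ser_mul _ _ _ _](_ : _ = cauchy (fun i => serG3 i N) (fun i => serP i N) n);
  last by rewrite ser_mulE; apply: eq_cauchy => // i; apply: ser_linE.
have P0 : chromsym (path_graph 0) N = 1 by rewrite chromsym_path big1 ?addr0.
have two1 : 2%:R - 1 = 1 :> rat by ring.
have P2 : chromsym (path_graph 2) N = 2 * elem 2 N.
  rewrite path_series_rec /cauchy !big_ord_recl big_ord0 /serG /= two1 scale1r P0; ring.
case: n => [|[|n]]; rewrite /ser_lin /= ?scale0r ?add0r.
- by rewrite /cauchy big_ord_recl big_ord0 /serG3 /= mul0r addr0 scaler0.
- by rewrite /cauchy !big_ord_recl big_ord0 /serG3 /= !mul0r !addr0 scaler0.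
rewrite scale1r twin_path_end // chromsym_twin P2.
(* Splitting G = e_2 z^2 + G_{>=3} isolates e_2 P, which after doubling cancels the term X_{P_2}
   X_{P_n} = 2 e_2 X_{P_n}. *)
have -> : chromsym (path_graph n.+2) N = elem n.+2 N + (elem 2 N * serP n N +
    cauchy (fun i => serG3 i N) (fun i => serP i N) n.+2).
  rewrite path_series_rec; congr (_ + _).
  transitivity (cauchy (fun i => (if i == 2%N then elem 2 N else 0) + serG3 i N)
      (fun i => serP i N) n.+2).
    apply: eq_cauchy => // -[|[|[|i]]]; rewrite /serG /serG3 /= ?addr0 ?add0r //.
    by rewrite two1 scale1r.
  rewrite cauchyDl; congr (_ + _).
  rewrite /cauchy !big_ord_recl /= !mul0r !add0r big1 ?addr0.
    by rewrite !subSS subn0.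
  by move=> i _; rewrite mul0r.
rewrite -[chromsym (path_graph n) N]/(serP n N) scaler_nat; ring.
Qed.

(** * Evaluation of the coefficients *)

(** Removing one part leaves a nonempty partition, so E_{>=2} and the constant term of P do not
    contribute. *)
Lemma twin_coefE lam : (2 <= size lam)%N ->
  twin_coef lam = 2 * lin_coef natG3 (lin_coef (fun a => a%:R) epsilon) lam.
Proof.
move=> sl.
have sr a : a \in lam -> (size (rem a lam) == 0%N) = false.
  by move=> al; rewrite size_rem //; case: (size lam) sl => [|[]].
congr (_ * _); rewrite [X in X + _]lin_coef_eq0 => [|a al]; last by rewrite sr ?mulr0.
by rewrite add0r; apply: eq_lin_coef => a al; rewrite /path_coef sr // add0r.
Qed.

(** [natG3] never selects the part 1, and epsilon vanishes as long as a 1 remains, so the added 1 is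
    removed by the inner operator, with weight 1. *)
Lemma twin_coef_cons1 mu : is_part mu -> (0 < size mu)%N ->
  twin_coef (part_union [:: 1%N] mu) = 2 * lin_coef natG3 epsilon mu.
Proof.
move=> pm sm; rewrite twin_coefE ?size_sort /=; last by lia.
congr (_ * _); rewrite (@lin_coef_perm _ _ (@lin_coef_perm _ _ epsilon_perm) _ (1%N :: mu)).
  rewrite lin_coef_cons1 //; apply: eq_lin_coef => b _; congr (_ * _).
  move: (rem b mu) => s {pm sm mu b}.
  rewrite /lin_coef (bigD1_seq 1%N) ?mem_undup ?mem_head ?undup_uniq //=.
  rewrite mul1r big1 ?addr0 // => a a1.
  by rewrite eq_sym (negPf a1) epsilon_eq0 ?mulr0 ?mem_head.
by rewrite perm_sort.
Qed.

Lemma twin_coef_no3 lam : (2 <= size lam)%N ->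
  (forall a, a \in lam -> (a < 3)%N) -> twin_coef lam = 0.
Proof.
move=> sl l3; rewrite twin_coefE // lin_coef_eq0 ?mulr0 // => a /l3 a3.
by rewrite /natG3 leqNgt a3 mul0r.
Qed.

(** Each factor G adds exactly one part, so G^k is the piece of 1 / (1 - G) supported on partitions
    with k parts. *)
Lemma e_expansion_serG_exp k :
  e_expansion (ser_exp serG k) (fun s => (size s == k)%:R * epsilon s).
Proof.
elim: k => [|k IH].
  apply: e_expansion_eq e_expansion_one => -[|a s] _; last by rewrite mul0r.
  by rewrite epsilon_nil mulr1.
have e := e_expansion_lin_mul (h := natG) erefl IH.
apply: (e_expansion_eq _ (e_expansion_ext _ e)) => [lam /andP[_ l0]|n N]; last first.
  by rewrite /= !ser_mulE; apply: eq_cauchy => // i; apply: ser_linE.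
case: lam l0 => [|a s] l0; first by rewrite /lin_coef big_nil mul0r.
rewrite (epsilon_lin_coef l0) // /lin_coef mulr_sumr; apply: eq_big_seq => b.
by rewrite mem_undup => /size_rem -> /=; rewrite eqSS; ring.
Qed.

(** Reordered as G_{>=3} (G (serG^k)), the product is two linear multiplications applied to a power
    of [serG]. With k two less than the number of parts, the size condition on that power holds
    after two removals. *)
Lemma e_coef_triple (g : nat -> rat) (G : symseries) lam :
  g 0%N = 0 -> (forall i N, ser_lin g i N = G i N) ->
  is_part lam -> (2 <= size lam)%N ->
  e_coef_is (ser_mul (ser_mul G serG3) (ser_exp serG (size lam - 2)%N)) lam
    (lin_coef natG3 (lin_coef g epsilon) lam).
Proof.
move=> g0 gG pl sl.
set k := (size lam - 2)%N.
have ext n N : ser_mul (ser_lin natG3) (ser_mul (ser_lin g) (ser_exp serG k)) n N =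
    ser_mul (ser_mul G serG3) (ser_exp serG k) n N.
  rewrite !ser_mulE; transitivity (cauchy (fun i => ser_lin natG3 i N)
    (cauchy (fun i => ser_lin g i N) (fun i => ser_exp serG k i N)) n) => //.
  rewrite cauchyA; apply: eq_cauchy => // i; rewrite cauchyC ser_mulE.
  by apply: eq_cauchy => // j; [exact: gG|exact: ser_linE].
have e := e_expansion_ext ext (e_expansion_lin_mul (h := natG3) erefl
  (e_expansion_lin_mul g0 (e_expansion_serG_exp k))).
split; first by eexists; exact: e.
move=> c ec; rewrite (e_expansion_uniq ec e pl); apply: eq_lin_coef => b bl.
congr (_ * _); apply: eq_lin_coef => a al.
by rewrite !size_rem // -subn2 eqxx mul1r.
Qed.

Lemma path_geq_nseq m k s : (2 <= m)%N -> path geq 2 s ->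
  path geq m (nseq k 2%N ++ s).
Proof.
move=> m2 ps; elim: k m m2 => [|k IH] m m2 /=; last by rewrite m2 IH.
by case: s ps => //= a s /andP[a2 ->]; rewrite andbT; apply: leq_trans a2 m2.
Qed.

Lemma lin_coef_sub2_cond (g h : nat -> rat) (P Q : pred nat) (s : seq nat) :
  lin_coef (fun b => if Q b then h b else 0)
    (lin_coef (fun a => if P a then g a else 0) epsilon) s =
  \sum_(a <- undup s | P a) \sum_(b <- undup s | Q b)
    g a * h b * epsilon_sub2 s a b.
Proof.
rewrite lin_coef_sub2 [RHS]big_mkcond; apply: eq_bigr => a _.
case: ifP => _; last by rewrite big1 // => b _; rewrite !mul0r.
rewrite [RHS]big_mkcond; apply: eq_bigr => b _.
by case: ifP => _ //; rewrite mulr0 mul0r.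
Qed.

Theorem corollary3p10
  (v : forall n : nat, path_graph n.+1)
  (v_end : forall n : nat, path_end (v n)) :
  (exists c : seq nat -> rat, e_expansion (serXPv v) c) /\
  forall c : seq nat -> rat, e_expansion (serXPv v) c ->
  (* (a) *)
  ((forall k : nat, (3 <= k)%N -> c [:: k] = 2 * k%:R) /\
   c [:: 2%N] = 2) /\
  (* (b) *)
  (forall k : nat, (4 <= k)%N -> c [:: (k - 1)%N; 1%N] = 2 * (k%:R - 2)) /\
  (* (c) *)
  (forall k : nat, (5 <= k)%N -> c [:: (k - 2)%N; 2%N] = 4 * (k%:R - 3)) /\
  (* (d) *)
  (forall i j : nat, (3 <= j)%N -> (j < i)%N ->
     c [:: i; j] = 2 * i%:R * (j%:R - 1) + 2 * j%:R * (i%:R - 1) /\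
     c [:: i; j] = 2 * (2 * i%:R * j%:R - i%:R - j%:R)) /\
  (* (e) *)
  (forall i : nat, (3 <= i)%N -> c [:: i; i] = 2 * i%:R * (i%:R - 1)) /\
  (* (f) *)
  (forall k : nat, (2 <= k)%N ->
     c (3%N :: nseq k 2%N) = 8 /\
     c (3%N :: nseq k 2%N ++ [:: 1%N]) = 4) /\
  (* (g) *)
  ((forall mu : seq nat, is_part mu -> (2 <= size mu)%N ->
      c (part_union [:: 1%N] mu) <> 0 ->
      1%N \notin mu /\ exists2 a : nat, (3 <= a)%N & a \in mu) /\
   (forall k : nat, c (nseq k 2%N ++ [:: 1%N]) = 0) /\
   (forall mu : seq nat, is_part mu -> (2 <= size mu)%N ->
      (exists2 d : rat,
         e_coef_is (ser_mul (ser_mul serG serG3) (ser_exp serG (size mu - 2)%N))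
                   mu d
         & c (part_union [:: 1%N] mu) = 2 * d) /\
      c (part_union [:: 1%N] mu) =
        2 * \sum_(a <- undup mu | (2 <= a)%N) \sum_(b <- undup mu | (3 <= b)%N)
              (a%:R - 1) * (b%:R - 1) * epsilon_sub2 mu a b)) /\
  (* (h) *)
  ((forall lam : seq nat, is_part lam -> 1%N \notin lam -> (2 <= size lam)%N ->
      c lam <> 0 -> exists2 a : nat, (3 <= a)%N & a \in lam) /\
   (forall k : nat, (2 <= k)%N -> c (nseq k 2%N) = 0) /\
   (forall lam : seq nat, is_part lam -> 1%N \notin lam -> (2 <= size lam)%N ->
      (exists2 d : rat,
         e_coef_is (ser_mul (ser_mul serK serG3) (ser_exp serG (size lam - 2)%N))
                   lam d
         & c lam = 2 * d) /\
      c lam =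
        2 * \sum_(a <- undup lam | (2 <= a)%N) \sum_(b <- undup lam | (3 <= b)%N)
              a%:R * (b%:R - 1) * epsilon_sub2 lam a b)).
Proof.
have eT := e_expansion_twin v_end.
split; first by exists twin_coef.
move=> c ec; have cE lam : is_part lam -> c lam = twin_coef lam.
  exact: e_expansion_uniq.
have part1 i : (0 < i)%N -> is_part [:: i].
  by rewrite /is_part /= inE => ?; lia.
have part2 i j : (0 < j <= i)%N -> is_part [:: i; j].
  by rewrite /is_part /= !inE /geq /= !andbT => ?; lia.
have big3 i : (3 <= i)%N -> natG3 i = i%:R - 1 by rewrite /natG3 => ->.
have c1E mu : is_part mu -> (0 < size mu)%N ->
    c (part_union [:: 1%N] mu) = 2 * lin_coef natG3 epsilon mu.
  move=> pm sm; rewrite cE ?twin_coef_cons1 // is_part_union //.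
  by case/andP: pm.
have append1 mu : is_part mu -> is_part (mu ++ [:: 1%N]) ->
    mu ++ [:: 1%N] = part_union [:: 1%N] mu.
  move=> pm pm1; apply: is_part_eq => //.
    by apply: is_part_union => //; case/andP: pm.
  by rewrite perm_sym perm_sort perm_catC.
have part22 k : is_part (nseq k 2%N).
  rewrite /is_part mem_nseq andbF andbT; case: k => //= k.
  by rewrite -(cats0 (nseq k 2%N)) path_geq_nseq.
have part221 k : is_part (nseq k 2%N ++ [:: 1%N]).
  rewrite /is_part mem_cat mem_nseq andbF andbT; case: k => //= k.
  by rewrite path_geq_nseq.
have part32 k s : path geq 2 s -> 0%N \notin s -> is_part (3%N :: nseq k 2%N ++ s).
  move=> ps s0; rewrite /is_part /= path_geq_nseq //.
  by rewrite inE mem_cat mem_nseq andbF.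
(* Only the part 3 has nonzero weight, namely 3 - 1 = 2. *)
have lin32 k f : lin_coef natG3 f (3%N :: nseq k 2%N) = 2 * f (nseq k 2%N).
  rewrite /lin_coef /= mem_nseq andbF big_cons /= big_seq big1 ?addr0 => [|a].
    by rewrite /natG3 /=; congr (_ * _); ring.
  by rewrite mem_undup mem_nseq => /andP[_ /eqP->]; rewrite mul0r.
split.
  split=> [k k3|]; rewrite cE /twin_coef ?lin_coef1 //.
  - by rewrite (ltnW k3) big3 // /path_coef /lin_coef big_nil /=; ring.
  - by apply: part1; lia.
  - by rewrite /natG3 /= mul0r addr0 !mulr1.
split.
  move=> k k4; rewrite -[[:: _; _]]/([:: (k - 1)%N] ++ [:: 1%N]) append1.
  - have pk : is_part [:: (k - 1)%N] by apply: part1; lia.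
    by rewrite c1E // lin_coef1 epsilon_nil big3 ?natrB; [ring|lia..].
  - by apply: part1; lia.
  - by apply: part2; lia.
(* Shared by (c) and (d): for j = 2 the second term drops out because [natG3 2] is 0. *)
have c2 i j : (0 < j < i)%N ->
    c [:: i; j] = 2 * (natG3 i * j%:R + natG3 j * i%:R).
  move=> ji; rewrite cE ?part2 ?twin_coefE //; last by lia.
  by rewrite lin_coef2 ?lin_coef1 ?epsilon_nil ?mulr1 //; lia.
split.
  move=> k k5; rewrite c2; last by lia.
  by rewrite big3 ?natrB /natG3 /=; [ring|lia..].
split.
  move=> i j j3 ji; rewrite c2; last by lia.
  by rewrite !big3 //; [split; ring|lia].
split.
  move=> i i3; rewrite cE ?part2 ?twin_coefE //; last by lia.
  rewrite (lin_coef_nseq _ _ 1) big3 // (lin_coef_nseq _ _ 0) epsilon_nil; ring.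
split.
  move=> [|k] // k2; split.
    rewrite cE; last by rewrite -[nseq _ _]cats0 part32.
    rewrite twin_coefE ?size_nseq // lin32 lin_coef_nseq epsilon_nseq2; ring.
  have p3 : is_part (3%N :: nseq k.+1 2%N) by rewrite -[nseq _ _]cats0 part32.
  rewrite -cat_cons append1 //; last exact: (part32 k.+1 [:: 1%N]).
  by rewrite c1E // lin32 epsilon_nseq2; ring.
split.
  split=> [mu pm sm|].
    rewrite c1E //; last by lia.
    move=> nz; split.
      (* A second 1 in [mu] survives the removal of any part other than 1 and makes epsilon
         vanish. *)
      apply/negP => m1; apply: nz; rewrite lin_coef_eq0 ?mulr0 // => a am.
      have [->|a1] := eqVneq a 1%N; first by rewrite mul0r.
      rewrite epsilon_eq0 ?mulr0 //.
      by move: m1; rewrite (perm_mem (perm_to_rem am)) inE eq_sym (negPf a1).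
    have [/hasP[a am a3]|/hasPn n3] := boolP (has (leq 3) mu); first by exists a.
    case: nz; rewrite lin_coef_eq0 ?mulr0 // => a /n3 a3.
    by rewrite /natG3 (negPf a3) mul0r.
  split=> [k|mu pm sm].
    rewrite cE //; case: k => [|k]; first by rewrite /twin_coef !lin_coef1 !mul0r addr0 mulr0.
    apply: twin_coef_no3; first by rewrite size_cat size_nseq /=; lia.
    by move=> a; rewrite mem_cat mem_nseq inE /= => /orP[]/eqP->.
  (* One more unfolding of epsilon exposes the factor G; it is legitimate because mu - b is
     nonempty. *)
  have -> : c (part_union [:: 1%N] mu) = 2 * lin_coef natG3 (lin_coef natG epsilon) mu.
    rewrite c1E; [|by []|by lia]; congr (_ * _); apply: eq_lin_coef => b bm.
    congr (_ * _); apply: epsilon_lin_coef; first by case/andP: (is_part_rem b pm).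
    by rewrite size_rem // -subn1 subn_gt0.
  split; last by rewrite lin_coef_sub2_cond.
  exists (lin_coef natG3 (lin_coef natG epsilon) mu) => //.
  by apply: e_coef_triple => // i N; apply: ser_linE.
split=> [lam pl l1 sl nz|].
  have [/hasP[a al a3]|/hasPn n3] := boolP (has (leq 3) lam); first by exists a.
  case: nz; rewrite cE // twin_coef_no3 // => a /n3; rewrite -ltnNge //.
split=> [k k2|lam pl l1 sl].
  rewrite cE //; apply: twin_coef_no3; first by rewrite size_nseq.
  by move=> a; rewrite mem_nseq => /andP[_ /eqP->].
(* The weights a and [natK a] differ only at a = 1, which is not a part here. *)
have -> : c lam = 2 * lin_coef natG3 (lin_coef natK epsilon) lam.
  rewrite cE // twin_coefE //; congr (_ * _); apply: eq_lin_coef => b bl.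
  congr (_ * _); apply: eq_lin_coef => -[|[|a]] // /mem_rem.
  by rewrite (negPf l1).
split; last by rewrite lin_coef_sub2_cond.
exists (lin_coef natG3 (lin_coef natK epsilon) lam) => //.
by apply: e_coef_triple => // i N; apply: ser_linE.
Qed.
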